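(* Let $\mathbb{F}$ be a field and let the $r\times n$ matrix $[I_r\mid D_1]$ be an $\mathbb{F}$-representation of a matroid $M$. Let $\{b_1,b_2,\ldots,b_k\}$ be a basis of the cycle matroid of the bipartite graph $G(D_1^{\#})$. Let $(\phi_1,\phi_2,\ldots,\phi_k)$ be an ordered $k$-tuple of elements of $\mathbb{F}$ such that, for each $i\in\{1,\ldots,k\}$, the entry of $D_1$ corresponding to $b_i$ is $\phi_i$ or $-\phi_i$. Let $[I_r\mid D']$ be the unique $\mathbb{F}$-representation of $M$ that is projectively equivalent to $[I_r\mid D_1]$ and such that, for each $i\in\{1,\ldots,k\}$, the entry of $D'$ corresponding to $b_i$ is $\phi_i$. Then $[I_r\mid D']$ can be obtained from $[I_r\mid D_1]$ by a sequence of row and column scalings by $\pm1$.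
   Context: Label the columns of $[I_r\mid D]$, in order, by $e_1,\ldots,e_n$; the rows of $D$ are labeled $e_1,\ldots,e_r$ and its columns $e_{r+1},\ldots,e_n$. $D^{\#}$ is the matrix obtained from $D$ by replacing each nonzero entry by $1$, with the same row and column labels. $G(D^{\#})$ is the simple bipartite graph with vertex classes $\{e_1,\ldots,e_r\}$ and $\{e_{r+1},\ldots,e_n\}$, in which $e_i$ and $e_j$ are adjacent if and only if $D^{\#}_{e_i,e_j}=1$; thus each edge of $G(D^{\#})$ corresponds to a nonzero entry of $D$. A basis of the cycle matroid of a graph is the edge set of a maximal spanning forest. Two $r\times n$ matrices over $\mathbb{F}$ representing the same matroid on the same labeled columns are projectively equivalent if one can be obtained from the other by elementary row operations and scalings of columns by nonzero elements of $\mathbb{F}$ (keeping column labels). By the theorem of Brylawski and Lucas, for every $k$-tuple $(\theta_1,\ldots,\theta_k)$ of nonzero elements of $\mathbb{F}$ there is a unique $\mathbb{F}$-representation $[I_r\mid D_2]$ of $M$ projectively equivalent to $[I_r\mid D_1]$ whose entry corresponding to $b_i$ is $\theta_i$ for every $i$; hence $[I_r\mid D']$ in the claim is well defined. *)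

(* Defs.v *)
From Stdlib Require Export Relation_Operators.
From mathcomp Require Export all_boot all_order all_algebra.

Set Implicit Arguments.
Unset Strict Implicit.
Unset Printing Implicit Defensive.

Import GRing.Theory.
Local Open Scope ring_scope.

(* A matroid whose ground set is the whole finite type [E]. *)
Record matroid (E : finType) := Matroid {
  indep : {set {set E}};
  indep_set0 : set0 \in indep;
  indep_subset : forall X Y : {set E},
    X \subset Y -> Y \in indep -> X \in indep;
  indep_augment : forall X Y : {set E},
    X \in indep -> Y \in indep -> (#|X| < #|Y|)%N ->
    exists2 y, y \in Y :\: X & y |: X \in indep
}.

(* The columns are taken as a family: a set of labels carrying two equal
   columns is dependent. *)
Definition represents (F : fieldType) (r n : nat)
    (A : 'M[F]_(r, n)) (M : matroid 'I_n) : Prop :=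
  forall X : {set 'I_n},
    (X \in indep M) = free [seq col j A | j <- enum X].

(* [I_r | D]; the label e_i is the i-th element of 'I_(r + m), so the first r
   labels (images of [lshift]) also index the rows of D and the last m
   (images of [rshift]) its columns. *)
Definition std_mx (F : fieldType) (r m : nat)
    (D : 'M[F]_(r, m)) : 'M[F]_(r, r + m) := row_mx 1%:M D.

Definition scale_row (F : fieldType) (r n : nat) (i : 'I_r) (a : F)
    (A : 'M[F]_(r, n)) : 'M[F]_(r, n) :=
  \matrix_(k, l) (if k == i then a * A k l else A k l).

Definition scale_col (F : fieldType) (r n : nat) (j : 'I_n) (a : F)
    (A : 'M[F]_(r, n)) : 'M[F]_(r, n) :=
  \matrix_(k, l) (if l == j then a * A k l else A k l).

(* Add [a] times row [i] to row [j]. *)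
Definition add_row (F : fieldType) (r n : nat) (i j : 'I_r) (a : F)
    (A : 'M[F]_(r, n)) : 'M[F]_(r, n) :=
  \matrix_(k, l) (if k == j then A k l + a * A i l else A k l).

Inductive projective_step (F : fieldType) (r n : nat) (A : 'M[F]_(r, n)) :
    'M[F]_(r, n) -> Prop :=
| ProjSwapRows (i j : 'I_r) : projective_step A (xrow i j A)
| ProjScaleRow (i : 'I_r) (a : F) :
    a != 0 -> projective_step A (scale_row i a A)
| ProjAddRow (i j : 'I_r) (a : F) :
    i != j -> projective_step A (add_row i j a A)
| ProjScaleCol (j : 'I_n) (a : F) :
    a != 0 -> projective_step A (scale_col j a A).

(* Every step can be undone by steps, so this is a symmetric relation. *)
Definition projectively_equivalent (F : fieldType) (r n : nat)
    (A B : 'M[F]_(r, n)) : Prop :=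
  clos_refl_trans _ (@projective_step F r n) A B.

Inductive sign_scaling_step (F : fieldType) (r n : nat) (A : 'M[F]_(r, n)) :
    'M[F]_(r, n) -> Prop :=
| SignScaleRow (i : 'I_r) (a : F) :
    a = 1 \/ a = -1 -> sign_scaling_step A (scale_row i a A)
| SignScaleCol (j : 'I_n) (a : F) :
    a = 1 \/ a = -1 -> sign_scaling_step A (scale_col j a A).

Definition sign_scaling_obtainable (F : fieldType) (r n : nat)
    (A B : 'M[F]_(r, n)) : Prop :=
  clos_refl_trans _ (@sign_scaling_step F r n) A B.

(* A simple graph on [V] is a symmetric irreflexive [e : rel V]; an edge is
   the set of its two ends. *)
Definition graph_edges (V : finType) (e : rel V) : {set {set V}} :=
  [set [set p.1; p.2] | p : V * V & e p.1 p.2].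

Definition is_forest (V : finType) (B : {set {set V}}) : Prop :=
  forall c : seq V, (2 < size c)%N ->
    ~~ ucycleb (fun x y => [set x; y] \in B) c.

(* Independent sets of the cycle matroid are the edge sets of forests; its
   bases are the maximal ones. *)
Definition cycle_matroid_basis (V : finType) (e : rel V)
    (B : {set {set V}}) : Prop :=
  [/\ B \subset graph_edges e,
      is_forest B
    & forall B' : {set {set V}},
        B' \subset graph_edges e -> is_forest B' -> B \subset B' -> B' = B].

(* D^# *)
Definition support_mx (F : fieldType) (r m : nat)
    (D : 'M[F]_(r, m)) : 'M[F]_(r, m) :=
  \matrix_(i, j) (if D i j == 0 then 0 else 1).

(* G(S) for a 0-1 matrix S. *)
Definition bip_graph (F : fieldType) (r m : nat) (S : 'M[F]_(r, m)) :
    rel 'I_(r + m) :=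
  fun x y => match split x, split y with
             | inl i, inr j => S i j == 1
             | inr j, inl i => S i j == 1
             | _, _ => false
             end.

Lemma bip_graph_sym (F : fieldType) (r m : nat) (S : 'M[F]_(r, m)) :
  symmetric (bip_graph S).
Proof. by move=> x y; rewrite /bip_graph; case: split; case: split. Qed.

Lemma bip_graph_irr (F : fieldType) (r m : nat) (S : 'M[F]_(r, m)) :
  irreflexive (bip_graph S).
Proof. by move=> x; rewrite /bip_graph; case: split. Qed.

(* The edge joining the label of row [p.1] to the label of column [p.2]; the
   entry corresponding to this edge is the one in position [p]. *)
Definition entry_edge (r m : nat) (p : 'I_r * 'I_m) : {set 'I_(r + m)} :=
  [set lshift m p.1; rshift r p.2].

Definition edge_entry (F : fieldType) (r m : nat) (D : 'M[F]_(r, m))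
    (b : {set 'I_(r + m)}) (x : F) : Prop :=
  exists2 p : 'I_r * 'I_m, b = entry_edge p & D p.1 p.2 = x.

(* Main.v *)
Require Import Defs.
From mathcomp Require Import all_boot all_order all_algebra.

(** A projective equivalence from [I_r | D1] to [I_r | D'] multiplies on the
    left by some matrix P and scales the columns by nonzero factors t.  Both
    matrices begin with an identity block, so P can only be the diagonal matrix
    that undoes t on the first r columns
    ([projective_equivalence_std_mx]): the entry in row k and column l
    is multiplied by t_l / t_k, where the row k shares the label of the k-th
    column.  So t is a potential on the vertices of the bipartite graph, and an
    entry is multiplied by the ratio of the potentials at the ends of its edge.

    On the edges of the basis B the hypothesis says that these ratios are 1 or
    -1, that is, that t^2 takes the same value at both ends.  Hence t^2 is
    constant on each component of B ([connect_invariant]).  Fix a root in every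
    component and put s_x = t_x / t_(root x); the two numbers have the same
    square, so s_x is 1 or -1.  A maximal forest connects the two ends of every
    edge of the graph ([basis_connects_edge]), so at a nonzero entry the values
    of t at both ends are divided by the same number and s has there the same
    ratio as t.  Thus s also carries [I_r | D1] to [I_r | D'], and it does so
    by scalings by signs ([sign_scaling_of_potential]). *)

Set Implicit Arguments.
Unset Strict Implicit.
Unset Printing Implicit Defensive.

Import GRing.Theory.
Local Open Scope ring_scope.

(** * Maximal forests *)

Lemma set2_eqP (V : finType) (x y u v : V) :
  [set x; y] = [set u; v] -> (x = u /\ y = v) \/ (x = v /\ y = u).
Proof.
move=> E; have /set2P xuv : x \in [set u; v] by rewrite -E set21.
have /set2P yuv : y \in [set u; v] by rewrite -E set22.
have /set2P uxy : u \in [set x; y] by rewrite E set21.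
have /set2P vxy : v \in [set x; y] by rewrite E set22.
by intuition congruence.
Qed.

Definition edge_rel (V : finType) (B : {set {set V}}) : rel V :=
  fun x y => [set x; y] \in B.

Lemma edge_rel_connect_sym (V : finType) (B : {set {set V}}) :
  connect_sym (edge_rel B).
Proof. by apply: sym_connect_sym => x y; rewrite /edge_rel setUC. Qed.

(** A cycle that uses the new edge would, after the removal of that edge, be
    a path inside B between the two ends. *)
Lemma forest_add_edge (V : finType) (B : {set {set V}}) (x y : V) :
  is_forest B -> ~~ connect (edge_rel B) x y -> is_forest ([set x; y] |: B).
Proof.
move=> forB nxy c c_gt2; apply/negP => /andP[].
rewrite -/(cycle (edge_rel ([set x; y] |: B)) c) => cyc_c uniq_c.
have nstep u v : [set u; v] = [set x; y] -> ~~ connect (edge_rel B) v u.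
  by case/set2_eqP=> -[-> ->]; rewrite // edge_rel_connect_sym.
have [/forallP noxy|] :=
    boolP [forall u, (u \in c) ==> ([set u; next c u] != [set x; y])].
  case/negP: (forB c c_gt2); rewrite /ucycleb uniq_c andbT.
  apply: cycle_from_next => // u uc.
  have /setU1P[E|//] := next_cycle cyc_c uc.
  by have:= noxy u; rewrite uc E eqxx.
rewrite negb_forall => /existsP[u]; rewrite negb_imply negbK.
case/andP=> uc /eqP uxy; have [i p rot_c] := rot_to uc.
move: c_gt2 cyc_c uniq_c uxy.
rewrite -(size_rot i) -(rot_cycle i) -(rot_uniq i) => c_gt2 cyc_c uniq_c.
rewrite -(next_rot i); last by rewrite -(rot_uniq i).
move: c_gt2 cyc_c uniq_c; rewrite rot_c {rot_c}.
case: p => [//|v [//|w p]] _ cyc_c uniq_c.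
rewrite [next _ u]/= eqxx => uvxy; case/negP: (nstep _ _ uvxy).
have /and3P[last_u _ path_p] :
    [&& edge_rel ([set x; y] |: B) (last v (w :: p)) u,
        edge_rel ([set x; y] |: B) u v
      & path (edge_rel ([set x; y] |: B)) v (w :: p)].
  by move: cyc_c; rewrite (cycle_path u).
have [u_notin v_notin] : u \notin v :: w :: p /\ v \notin w :: p.
  by move: uniq_c; rewrite 2!cons_uniq => /and3P[].
(* Only the step from u to v is the new edge: the steps of the path from v to
   its last vertex avoid u, and that last vertex is not v. *)
apply: (@connect_trans _ _ (last v (w :: p))).
  apply/connectP; exists (w :: p) => //.
  apply: (sub_in_path (P := predC1 u)) path_p.
    move=> a b /= au bu /setU1P[E|//].
    case/set2_eqP: (etrans E (esym uvxy)) => -[aE bE].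
      by rewrite inE aE eqxx in au.
    by rewrite inE bE eqxx in bu.
  by apply/allP => z zp /=; apply: contraNneq u_notin => <-.
apply: connect1; have /setU1P[E|//] := last_u.
have lastp : last v (w :: p) \in w :: p by exact: (mem_last w p).
case/set2_eqP: (etrans E (esym uvxy)) => -[zE uE].
  by rewrite -zE inE lastp orbT in u_notin.
by rewrite -zE lastp in v_notin.
Qed.

Lemma basis_connects_edge (V : finType) (e : rel V) (B : {set {set V}})
    (x y : V) :
  cycle_matroid_basis e B -> e x y -> connect (edge_rel B) x y.
Proof.
case=> subB forB maxB exy; apply/contraT => nxy.
have xyE : [set x; y] \in graph_edges e by apply/imsetP; exists (x, y); rewrite ?inE.
have defB : [set x; y] |: B = B.
  apply: maxB; last exact: subsetUr.
    by rewrite subUset sub1set xyE.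
  exact: forest_add_edge.
by case/negP: nxy; apply: connect1; rewrite /edge_rel -defB setU11.
Qed.

Lemma connect_invariant (V : finType) (T : eqType) (e : rel V) (f : V -> T) :
  connect_sym e -> (forall x y, e x y -> f x = f y) ->
  forall x y, connect e x y -> f x = f y.
Proof.
move=> sym_e fe x y xy.
have cl : closed e [pred z | f z == f x].
  by move=> a b /fe fab; rewrite !inE fab.
by have:= closed_connect cl xy; rewrite !inE eqxx => /esym/eqP.
Qed.

(** * Edges of the bipartite graph and entries of the matrix *)

Lemma bip_graph_lr (F : fieldType) (r m : nat) (D : 'M[F]_(r, m)) i j :
  bip_graph (support_mx D) (lshift m i) (rshift r j) = (D i j != 0).
Proof.
rewrite /bip_graph -[lshift m i]/(unsplit (inl i)).
rewrite -[rshift r j]/(unsplit (inr j)) !unsplitK mxE.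
by case: (D i j == 0); rewrite ?eqxx // eq_sym oner_eq0.
Qed.

Lemma entry_edge_inj (r m : nat) : injective (@entry_edge r m).
Proof.
move=> [i j] [i' j'] /set2_eqP[[/= /lshift_inj-> /rshift_inj->]//|[/= /eqP]].
by rewrite eq_lrshift.
Qed.

Lemma entry_edge_graph (F : fieldType) (r m : nat) (D : 'M[F]_(r, m)) p :
  (entry_edge p \in graph_edges (bip_graph (support_mx D))) = (D p.1 p.2 != 0).
Proof.
rewrite -bip_graph_lr; apply/imsetP/idP => [[[x y]]|Dp].
  by rewrite inE /= => gxy /set2_eqP[] [-> ->] //; rewrite bip_graph_sym.
by exists (lshift m p.1, rshift r p.2); rewrite ?inE.
Qed.

(** * Projective equivalences between standard matrices *)

Lemma projective_equivalence_mulmx (F : fieldType) (r n : nat)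
    (A B : 'M[F]_(r, n)) :
  projectively_equivalent A B ->
  exists P : 'M[F]_r, exists2 t : 'I_n -> F,
    forall l, t l != 0 & forall k l, B k l = (P *m A) k l * t l.
Proof.
elim=> {A B} [A B [i j|i a a0|i j a ij|j a a0]|A|A B C _ [P [t t0 tE]] _ [Q [u u0 uE]]].
- exists (tperm_mx i j), (fun=> 1) => [l|k l]; first exact: oner_neq0.
  by rewrite -xrowE mulr1.
- exists (diag_mx (\row_k (if k == i then a else 1))), (fun=> 1) => [l|k l].
    exact: oner_neq0.
  by rewrite mul_diag_mx !mxE mulr1; case: eqP; rewrite ?mul1r.
- exists (1%:M + a *: delta_mx j i), (fun=> 1) => [l|k l]; first exact: oner_neq0.
  rewrite mulmxDl mul1mx -scalemxAl !mxE mulr1 (bigD1 i) //= big1 => [|z zi].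
    by rewrite mxE eqxx andbT addr0; case: eqP; rewrite ?mul1r ?mul0r ?mulr0 ?addr0.
  by rewrite mxE (negbTE zi) andbF mul0r.
- exists 1%:M, (fun l => if l == j then a else 1) => [l|k l].
    by case: ifP => _; [exact: a0|exact: oner_neq0].
  by rewrite mul1mx mxE; case: eqP; rewrite ?mulr1 // mulrC.
- exists 1%:M, (fun=> 1) => [l|k l]; first exact: oner_neq0.
  by rewrite mul1mx mulr1.
- exists (Q *m P), (fun l => t l * u l) => [l|k l]; first by rewrite mulf_neq0.
  rewrite uE mulrA; congr (_ * _); rewrite -mulmxA mxE [in RHS]mxE mulr_suml.
  by apply: eq_bigr => i _; rewrite tE mulrA.
Qed.

Lemma std_mxL (F : fieldType) (r m : nat) (D : 'M[F]_(r, m)) k i :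
  std_mx D k (lshift m i) = (k == i)%:R.
Proof. by rewrite row_mxEl mxE. Qed.

Lemma projective_equivalence_std_mx (F : fieldType) (r m : nat)
    (D D' : 'M[F]_(r, m)) :
  projectively_equivalent (std_mx D) (std_mx D') ->
  exists2 t : 'I_(r + m) -> F, forall x, t x != 0
    & forall k l, std_mx D' k l = (t (lshift m k))^-1 * std_mx D k l * t l.
Proof.
case/projective_equivalence_mulmx=> P [t t0 tE]; exists t => // k l.
(* The identity blocks force P to invert t on the first r columns. *)
have PE i j : P i j = (i == j)%:R * (t (lshift m j))^-1.
  have:= tE i (lshift m j); rewrite std_mxL => ->.
  rewrite mulfK // mxE (bigD1 j) //= big1 => [|z zj].
    by rewrite std_mxL eqxx mulr1 addr0.
  by rewrite std_mxL (negbTE zj) mulr0.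
rewrite tE mxE (bigD1 k) //= big1 => [|z zk].
  by rewrite PE eqxx mul1r addr0.
by rewrite PE eq_sym (negbTE zk) !mul0r.
Qed.

(** * Scalings by signs *)

Lemma sign_scaling_rows (F : fieldType) (r n : nat) (s : 'I_r -> F)
    (A : 'M[F]_(r, n)) :
  (forall k, s k = 1 \/ s k = -1) ->
  sign_scaling_obtainable A (\matrix_(k, l) (s k * A k l)).
Proof.
move=> s1.
suff H (xs : seq 'I_r) : uniq xs -> sign_scaling_obtainable A
    (\matrix_(k, l) (if k \in xs then s k * A k l else A k l)).
  have:= H _ (enum_uniq 'I_r); congr (sign_scaling_obtainable _ _).
  by apply/matrixP => k l; rewrite !mxE mem_enum.
elim: xs => [_|x xs IH /= /andP[x_xs /IH{IH}IH]].
  rewrite (_ : \matrix_(_, _) _ = A); first exact: rt_refl.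
  by apply/matrixP => k l; rewrite mxE.
apply: rt_trans IH _; apply: rt_step.
set B := \matrix_(_, _) _; set C := \matrix_(_, _) _.
rewrite (_ : C = scale_row x (s x) B); first exact: SignScaleRow.
apply/matrixP => k l; rewrite !mxE inE.
by case: eqP => [->|//]; rewrite (negbTE x_xs).
Qed.

Lemma sign_scaling_cols (F : fieldType) (r n : nat) (t : 'I_n -> F)
    (A : 'M[F]_(r, n)) :
  (forall l, t l = 1 \/ t l = -1) ->
  sign_scaling_obtainable A (\matrix_(k, l) (A k l * t l)).
Proof.
move=> t1.
suff H (xs : seq 'I_n) : uniq xs -> sign_scaling_obtainable A
    (\matrix_(k, l) (if l \in xs then A k l * t l else A k l)).
  have:= H _ (enum_uniq 'I_n); congr (sign_scaling_obtainable _ _).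
  by apply/matrixP => k l; rewrite !mxE mem_enum.
elim: xs => [_|x xs IH /= /andP[x_xs /IH{IH}IH]].
  rewrite (_ : \matrix_(_, _) _ = A); first exact: rt_refl.
  by apply/matrixP => k l; rewrite mxE.
apply: rt_trans IH _; apply: rt_step.
set B := \matrix_(_, _) _; set C := \matrix_(_, _) _.
rewrite (_ : C = scale_col x (t x) B); first exact: SignScaleCol.
apply/matrixP => k l; rewrite !mxE inE.
by case: eqP => [->|//]; rewrite (negbTE x_xs) mulrC.
Qed.

Lemma sign_scaling_rows_cols (F : fieldType) (r n : nat)
    (s : 'I_r -> F) (t : 'I_n -> F) (A B : 'M[F]_(r, n)) :
  (forall k, s k = 1 \/ s k = -1) -> (forall l, t l = 1 \/ t l = -1) ->
  (forall k l, B k l = s k * A k l * t l) -> sign_scaling_obtainable A B.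
Proof.
move=> s1 t1 BE; apply: rt_trans (sign_scaling_rows A s1) _.
set C := \matrix_(_, _) _.
rewrite (_ : B = \matrix_(k, l) (C k l * t l)); first exact: sign_scaling_cols.
by apply/matrixP => k l; rewrite BE !mxE.
Qed.

(** Dividing a potential by its value at a chosen root of each component of B
    leaves the ratio at each nonzero entry unchanged, since the two ends of
    the corresponding edge have the same root.  When t^2 is constant on the
    components, the quotients are signs. *)
Lemma sign_scaling_of_potential (F : fieldType) (r m : nat)
    (D D' : 'M[F]_(r, m)) (B : {set {set 'I_(r + m)}}) (t : 'I_(r + m) -> F) :
  cycle_matroid_basis (bip_graph (support_mx D)) B ->
  (forall x, t x != 0) ->
  (forall x y, edge_rel B x y -> t x ^+ 2 = t y ^+ 2) ->
  (forall k l, std_mx D' k l = (t (lshift m k))^-1 * std_mx D k l * t l) ->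
  sign_scaling_obtainable (std_mx D) (std_mx D').
Proof.
move=> basisB t0 tB tE; have symB := @edge_rel_connect_sym _ B.
pose rt := fingraph.root (edge_rel B); pose s x := t x / t (rt x).
have s1 x : s x = 1 \/ s x = -1.
  have: t x ^+ 2 == t (rt x) ^+ 2.
    by apply/eqP/(connect_invariant symB tB)/connect_root.
  by rewrite eqf_sqr /s => /orP[] /eqP ->; [left|right];
    rewrite ?mulNr divff.
have sV x : (s x)^-1 = s x by case: (s1 x) => ->; rewrite ?invrN invr1.
apply: (@sign_scaling_rows_cols _ _ _ (fun k => s (lshift m k)) s) => // k l.
rewrite tE; have [->|Akl] := eqVneq (std_mx D k l) 0; first by rewrite !mulr0 !mul0r.
suff /(fingraph.rootP symB) rtE : connect (edge_rel B) (lshift m k) l.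
  rewrite -(sV (lshift m k)) /s /rt rtE invf_div.
  by rewrite [RHS]mulrA [RHS]mulrC -!mulrA mulKf.
move: Akl; case: (split_ordP l) => j ->.
  by rewrite std_mxL; have [->|_] := eqVneq k j; rewrite ?connect0 ?eqxx.
rewrite row_mxEr => Dkj; apply: (basis_connects_edge basisB).
by rewrite bip_graph_lr.
Qed.

Theorem lemma6p3p1 (F : fieldType) (r m : nat)
    (M : matroid 'I_(r + m)) (D1 : 'M[F]_(r, m))
    (D1_rep : represents (std_mx D1) M)
    (k : nat) (b : k.-tuple {set 'I_(r + m)})
    (b_uniq : uniq b)
    (b_basis : cycle_matroid_basis (bip_graph (support_mx D1)) [set:: b])
    (phi : k.-tuple F)
    (phi_D1 : forall i : 'I_k,
       edge_entry D1 (tnth b i) (tnth phi i) \/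
       edge_entry D1 (tnth b i) (- tnth phi i))
    (D' : 'M[F]_(r, m))
    (D'_rep : represents (std_mx D') M)
    (D'_proj : projectively_equivalent (std_mx D1) (std_mx D'))
    (D'_phi : forall i : 'I_k, edge_entry D' (tnth b i) (tnth phi i)) :
  sign_scaling_obtainable (std_mx D1) (std_mx D').
Proof.
have [t t0 tE] := projective_equivalence_std_mx D'_proj.
apply: (sign_scaling_of_potential b_basis t0 _ tE) => x y.
rewrite /edge_rel inE => /tnthP[i bi].
have [p bp D'p] := D'_phi i.
have D1p : D1 p.1 p.2 = tnth phi i \/ D1 p.1 p.2 = - tnth phi i.
  by case: (phi_D1 i) => -[q bq <-]; move: bq; rewrite bp => /entry_edge_inj->;
    [left|right].
have D1p0 : D1 p.1 p.2 != 0.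
  rewrite -entry_edge_graph -bp; case: b_basis => /subsetP sub_b _ _.
  by apply: sub_b; rewrite inE mem_tnth.
have D'E := tE p.1 (rshift r p.2); rewrite !row_mxEr in D'E.
have sq : t (lshift m p.1) ^+ 2 = t (rshift r p.2) ^+ 2.
  apply: (mulfI (expf_neq0 2 D1p0)).
  have D'sq : D' p.1 p.2 ^+ 2 = D1 p.1 p.2 ^+ 2.
    by rewrite D'p; case: D1p => ->; rewrite ?sqrrN.
  by rewrite -{1}D'sq D'E -!exprMn mulrC -!mulrA mulVKf.
by move: bi; rewrite bp => /set2_eqP[] [-> ->].
Qed.
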